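(* There is a constant $0<\kappa<1$, independent of $p^-$ and $p^+$, such that the following hold for $\Phi$, $\varphi$, $p^\pm$ as in the context and $\psi(s)=\varphi(s)/s$. (1) If $\gamma\ge\Big(\inf_{t>0}\frac{t\varphi(t)}{\Phi(t)}\Big)^{-1}$, then for all $\xi,\eta\in\mathbb{R}^d$, $$\langle\psi(|\xi|)\xi-\psi(|\eta|)\eta,\xi-\eta\rangle\ge c^-p^-\min\left\{\frac{\Phi^{1+\gamma}(3^{-1/2}|\xi-\eta|)}{\Phi^\gamma(|\xi|+|\eta|)},\frac{\Phi^{1+\gamma}(\kappa^{1/2}|\xi-\eta|)}{4\,\Phi^\gamma(|\xi|+|\eta|)}\right\},$$ where $c^-=\min\{p^--1,1\}$. (2) If $p^-\ge2$, then for all $\xi,\eta\in\mathbb{R}^d$, $$\langle\psi(|\xi|)\xi-\psi(|\eta|)\eta,\xi-\eta\rangle\ge\min\left\{\Phi(|\xi-\eta|),\frac{p^-}{4}\Phi(\kappa^{1/2}|\xi-\eta|)\right\}.$$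
   Context: $\varphi\in C([0,\infty))\cap C^1((0,\infty))$, $\varphi(s)>0$ for $s>0$, and there are constants $p^-,p^+$ with $0<p^--1\le\frac{s\varphi'(s)}{\varphi(s)}\le p^+-1$ for all $s>0$. $\Phi(s)=\int_0^s\varphi(t)\,dt$; it satisfies $p^-\le\frac{s\varphi(s)}{\Phi(s)}\le p^+$ for $s>0$. $\Phi^{\gamma}(s)$ means $(\Phi(s))^\gamma$. Conventions: $\psi(|0|)0=0$, and the right-hand side of (1) is read as $0$ when $\xi=\eta=0$. *)

(* Defs.v *)
From HB Require Import structures.
From mathcomp Require Import all_boot all_order all_algebra.
From mathcomp Require Import all_classical all_reals all_analysis.

Set Implicit Arguments.
Unset Strict Implicit.
Unset Printing Implicit Defensive.

Import Order.TTheory GRing.Theory Num.Theory.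
Import numFieldNormedType.Exports.

Local Open Scope classical_set_scope.
Local Open Scope ring_scope.

Definition dot (R : realType) (d : nat) (u v : 'rV[R]_d) : R :=
  \sum_(i < d) u 0 i * v 0 i.

(* The library norm on 'rV[R]_d is the sup norm, hence this separate
   definition of the Euclidean one. *)
Definition enorm (R : realType) (d : nat) (u : 'rV[R]_d) : R :=
  Num.sqrt (dot u u).

(* phi is a total function on R, but only its values on [0, +oo[ matter.
   The first three clauses say that phi is in C([0,oo)) and C^1((0,oo)). *)
Definition admissible (R : realType) (pm pp : R) (phi : R -> R) : Prop :=
  [/\ {within `[0, +oo[, continuous phi},
      (forall s : R, 0 < s -> derivable phi s 1),
      (forall s : R, 0 < s -> {for s, continuous (derive1 phi)}),
      (forall s : R, 0 < s -> 0 < phi s) &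
      0 < pm - 1 /\
      (forall s : R, 0 < s -> pm - 1 <= s * derive1 phi s / phi s <= pp - 1)].

Definition Phi (R : realType) (phi : R -> R) (s : R) : R :=
  \int[lebesgue_measure]_(t in `[0, s]) phi t.

Definition psi (R : realType) (phi : R -> R) (s : R) : R := phi s / s.

(* psi(|xi|) xi; at xi = 0 this is 0, whatever the value of psi at 0. *)
Definition field_of (R : realType) (phi : R -> R) (d : nat)
    (xi : 'rV[R]_d) : 'rV[R]_d :=
  psi phi (enorm xi) *: xi.

(* The infimum of t * phi t / Phi t over t > 0.  For admissible phi this set
   is bounded below (by pm), so that inf is the genuine infimum. *)
Definition lower_index (R : realType) (phi : R -> R) : R :=
  inf [set t * phi t / Phi phi t | t in [set t : R | 0 < t]].

(* Phi^(1+gamma)(a) / Phi^gamma(b).  Since 0 `^ r = 0 for r != 0 and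
   x / 0 = 0, this is 0 at a = b = 0 whenever gamma > 0. *)
Definition Phi_quot (R : realType) (phi : R -> R) (gamma a b : R) : R :=
  Phi phi a `^ (1 + gamma) / Phi phi b `^ gamma.

(* Main.v *)
Require Import Defs.
From HB Require Import structures.
From mathcomp Require Import all_boot all_order all_algebra.
From mathcomp Require Import all_classical all_reals all_analysis.
From mathcomp Require Import ring lra.

Import Order.TTheory GRing.Theory Num.Theory.
Import numFieldNormedType.Exports.
Local Open Scope ring_scope.

(** The value [kappa = 1/4] works, and in both inequalities it is the second
    entry of the minimum that bounds the left-hand side from below.

    Write [a] for the larger of [|xi|] and [|eta|], [b] for the smaller,
    [r = |xi - eta|], [h = r / 2] and [c = min (pm - 1) 1].  The triangle
    inequality gives [h <= a].

    Coercivity ([field_of_coercive]).  The lower bound on [s phi'(s) / phi(s)]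
    makes [phi(s) / s ^ c] nondecreasing, and [c <= 1] turns the resulting
    [phi(b) <= (b / a) ^ c phi(a)] into
    [phi(a) - phi(b) >= c psi(a) (a - b)] by Bernoulli's inequality.  Since the
    left-hand side, when [b > 0], equals
    [(phi(a) - phi(b)) (a - b) + (psi(a) + psi(b)) (a b - <xi, eta>)]
    and [r ^ 2 = (a - b) ^ 2 + 2 (a b - <xi, eta>)], it is at least
    [(c / 2) psi(a) r ^ 2 = 2 c h ^ 2 phi(a) / a].

    It remains to compare [h ^ 2 phi(a) / a] with [Phi].  Always
    [pm Phi(h) <= h phi(h)] ([pm_Phi_le]).

    If [pm >= 2], then [c = 1] and [phi(h) <= (h / a) phi(a)], so that
    [pm Phi(h) <= h ^ 2 phi(a) / a], which is more than enough for the second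
    inequality.

    For the first one, use [phi(h) <= phi(a)] to get [pm Phi(h) <= h phi(a)];
    the missing factor [h / a] comes from the quotient of the values of [Phi].
    With [m] the infimum of [t phi(t) / Phi(t)], the function [Phi(s) / s ^ m]
    is nondecreasing, so [(Phi(h) / Phi(|xi| + |eta|)) ^ gamma] is at most
    [(h / (|xi| + |eta|)) ^ (m gamma)], hence at most [h / a], because
    [m gamma >= 1] ([Phi_ratio_powR]). *)

(** * Euclidean geometry of row vectors *)

Section Euclidean.
Context {R : realType} {d : nat}.
Implicit Types u v w : 'rV[R]_d.

Lemma dotC u v : dot u v = dot v u.
Proof. by apply: eq_bigr => i _; rewrite mulrC. Qed.

Lemma dotDl u v w : dot (u + v) w = dot u w + dot v w.
Proof. by rewrite -big_split; apply: eq_bigr => ? _; rewrite mxE mulrDl. Qed.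

Lemma dotZl k u v : dot (k *: u) v = k * dot u v.
Proof. by rewrite /dot mulr_sumr; apply: eq_bigr => i _; rewrite mxE mulrA. Qed.

Lemma dotBl u v w : dot (u - v) w = dot u w - dot v w.
Proof. by rewrite dotDl -[- v]scaleN1r dotZl mulN1r. Qed.

Lemma dotBr u v w : dot w (u - v) = dot w u - dot w v.
Proof. by rewrite dotC dotBl !(dotC w). Qed.

Lemma dotZr k u v : dot u (k *: v) = k * dot u v.
Proof. by rewrite dotC dotZl dotC. Qed.

Lemma dot0l v : dot 0 v = 0.
Proof. by rewrite -(scale0r v) dotZl mul0r. Qed.

Lemma dot_ge0 u : 0 <= dot u u.
Proof. by apply: sumr_ge0 => i _; rewrite -expr2 sqr_ge0. Qed.

Lemma enorm_ge0 u : 0 <= enorm u.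
Proof. exact: sqrtr_ge0. Qed.

Lemma sqr_enorm u : enorm u ^+ 2 = dot u u.
Proof. by rewrite sqr_sqrtr ?dot_ge0. Qed.

Lemma enorm0_eq0 u : enorm u = 0 -> u = 0.
Proof.
move=> u0; have := sqr_enorm u; rewrite u0 expr0n/= => /esym/eqP.
rewrite psumr_eq0 => [/allP h|i _]; last by rewrite -expr2 sqr_ge0.
apply/rowP => i; rewrite mxE; apply/eqP.
by have := h i (mem_index_enum i); rewrite /= mulf_eq0 orbb.
Qed.

(** Expanding [0 <= | |v| u - |u| v | ^ 2] gives Cauchy-Schwarz after division by
    [2 |u| |v|]; the degenerate cases are separate. *)
Lemma dot_le_enorm u v : dot u v <= enorm u * enorm v.
Proof.
have [u0|nu0] := eqVneq (enorm u) 0.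
  by rewrite (enorm0_eq0 _ u0) dot0l mulr_ge0 ?enorm_ge0.
have [v0|nv0] := eqVneq (enorm v) 0.
  by rewrite (enorm0_eq0 _ v0) dotC dot0l mulr_ge0 ?enorm_ge0.
have u_gt0 : 0 < enorm u by rewrite lt_def nu0 enorm_ge0.
have v_gt0 : 0 < enorm v by rewrite lt_def nv0 enorm_ge0.
have := dot_ge0 (enorm v *: u - enorm u *: v).
rewrite !(dotBl, dotBr, dotZl, dotZr) (dotC v u) -!sqr_enorm => h.
rewrite -(ler_pM2l (mulr_gt0 u_gt0 v_gt0)); lra.
Qed.

Lemma enormB u v : enorm (u - v) = enorm (v - u).
Proof. by rewrite /enorm -opprB -scaleN1r dotZl dotZr !mulN1r opprK. Qed.

Lemma sqr_enormB u v :
  enorm (u - v) ^+ 2 = enorm u ^+ 2 + enorm v ^+ 2 - 2 * dot u v.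
Proof. rewrite !sqr_enorm !(dotBl, dotBr) (dotC v u); ring. Qed.

Lemma enormB_le u v : enorm (u - v) <= enorm u + enorm v.
Proof.
have s_ge0 : 0 <= enorm u + enorm v by rewrite addr_ge0 ?enorm_ge0.
rewrite -ler_sqr ?nnegrE ?enorm_ge0// sqr_enormB.
have := dot_le_enorm u (- 1 *: v); rewrite dotZr.
have -> : enorm (-1 *: v) = enorm v.
  by rewrite /enorm dotZl dotZr !mulN1r opprK.
nra.
Qed.

End Euclidean.

(** * Power growth *)

(** Multiplicative form of the monotonicity of [f(s) / s ^ k] on the positive
    half-line. *)
Definition power_growth {R : realType} (k : R) (f : R -> R) :=
  forall x y : R, 0 < x -> x <= y -> f x <= (x / y) `^ k * f y.

(** The hypothesis says that the derivative of [s ^ (- k) f(s)], namely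
    [s ^ (- k - 1) (s f'(s) - k f(s))], is nonnegative.  It serves both for
    [phi] and for [Phi]. *)
Lemma log_derivative_power_growth {R : realType} (k : R) (f : R -> R) :
  (forall s : R, 0 < s -> derivable f s 1) ->
  (forall s : R, 0 < s -> k * f s <= s * derive1 f s) -> power_growth k f.
Proof.
move=> df kf x y x0 xy.
have y0 : 0 < y := lt_le_trans x0 xy.
pose g (s : R) := s `^ (- k) * f s.
have dg (s : R) : 0 < s ->
    is_derive s 1 g (s `^ (- k) * derive1 f s + f s * (- k * s `^ (- k - 1))).
  move=> s0; have fs : is_derive s 1 f (derive1 f s).
    by rewrite derive1E; apply: DeriveDef => //; exact: df.
  have ps := @is_derive1_powR R (- k) s s0.
  exact: (is_deriveM ps fs).
have gg (s : R) : 0 < s -> 0 <= derive1 g s.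
  move=> s0; rewrite derive1E (@derive_val _ _ _ _ _ _ _ (dg _ s0)).
  have -> : s `^ (- k - 1) = s `^ (- k) / s.
    by rewrite powRB ?(gt_eqF s0)/= ?implybT// powRr1 ?ltW.
  have -> : s `^ (- k) * derive1 f s + f s * (- k * (s `^ (- k) / s)) =
      s `^ (- k) / s * (s * derive1 f s - k * f s).
    by field; rewrite gt_eqF.
  by apply: mulr_ge0; [rewrite divr_ge0 ?powR_ge0 ?ltW | rewrite subr_ge0 kf].
have gxy : g x <= g y.
  have pos (z : R) : z \in `]0, (y + 1)[ -> 0 < z by rewrite in_itv/= => /andP[].
  apply: (@ger0_derive1_le_oo _ g 0 (y + 1)) => //.
  - by move=> z /pos z0; have := dg _ z0; case.
  - by move=> z /pos z0; exact: gg.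
  - move=> z; rewrite inE/= => /pos z0.
    by apply/differentiable_continuous/derivable1_diffP; have := dg _ z0; case.
  - by rewrite in_itv/= x0; lra.
  - by rewrite in_itv/= y0; lra.
rewrite powRM ?invr_ge0 ?(ltW x0) ?(ltW y0)// -[y^-1]powR_inv1 ?(ltW y0)//.
rewrite -powRrM mulN1r -mulrA.
have -> : f x = x `^ k * g x.
  by rewrite /g mulrA -powRD ?(gt_eqF x0) ?implybT// subrr powRr0 mul1r.
by rewrite ler_wpM2l ?powR_ge0.
Qed.

(** Bernoulli's inequality.  With [u = ln x], the tangent bounds
    [exp ((1 - c) u) >= 1 + (1 - c) u] and [exp (- c u) >= 1 - c u] weighted by
    [c] and [1 - c] have a sum in which the terms in [u] cancel; multiplying by
    [exp (c u) = x ^ c] gives the claim. *)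
Lemma powR_le_affine {R : realType} (x c : R) :
  0 < x -> 0 <= c <= 1 -> x `^ c <= c * x + (1 - c).
Proof.
move=> x0 /andP[c0 c1].
pose u := ln x.
have -> : x `^ c = expR (c * u) by rewrite /powR gt_eqF.
have xE : x = expR (c * u) * expR ((1 - c) * u).
  by rewrite -expRD -mulrDl addrC subrK mul1r lnK// posrE.
have E1 : 1 = expR (c * u) * expR (- (c * u)) by rewrite -expRD subrr expR0.
have e0 := expR_gt0 (c * u).
have h1 := expR_ge1Dx ((1 - c) * u).
have h2 := expR_ge1Dx (- (c * u)).
have h : 1 <= c * expR ((1 - c) * u) + (1 - c) * expR (- (c * u)).
  have := ler_wpM2l c0 h1.
  have c1' : 0 <= 1 - c by lra.
  have := ler_wpM2l c1' h2.
  lra.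
have := ler_wpM2l (ltW e0) h.
have -> : expR (c * u) *
      (c * expR ((1 - c) * u) + (1 - c) * expR (- (c * u))) =
    c * (expR (c * u) * expR ((1 - c) * u)) +
    (1 - c) * (expR (c * u) * expR (- (c * u))) by ring.
by rewrite -xE -E1 !mulr1.
Qed.

(** * Coercivity of the vector field *)

(** When [eta] is not zero, let [a], [b] be the two norms, [A], [B] the values of
    [psi] there and [D] the inner product.  The difference of the two sides is
    [h1 + h2 + h3 + h4 / 2], where the nonnegative terms [h1], [h2], [h3], [h4]
    are those of the proof. *)
Lemma field_of_coercive_ordered {R : realType} {d : nat}
    (phi : R -> R) (c : R) (xi eta : 'rV[R]_d) :
  (forall s : R, 0 < s -> 0 < phi s) -> 0 <= c <= 1 -> power_growth c phi ->
  enorm eta <= enorm xi ->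
  c / 2 * psi phi (enorm xi) * enorm (xi - eta) ^+ 2 <=
  dot (field_of phi xi - field_of phi eta) (xi - eta).
Proof.
move=> phi0 /andP[c0 c1] phic ba.
rewrite sqr_enormB /field_of !(dotBl, dotBr, dotZl) (dotC eta xi) -!sqr_enorm.
have Dab := dot_le_enorm xi eta.
have b0 := enorm_ge0 eta.
have [a0|na0] := eqVneq (enorm xi) 0.
  have xi0 := enorm0_eq0 _ a0.
  have eta0 : eta = 0 by apply/enorm0_eq0/le_anti; rewrite b0 -a0 ba.
  have -> : enorm eta = 0 by rewrite eta0 -xi0.
  rewrite a0 xi0 dot0l; lra.
have a0 : 0 < enorm xi by rewrite lt_def na0 enorm_ge0.
have A0 : 0 < psi phi (enorm xi) by rewrite divr_gt0 ?phi0.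
have [eb0|nb0] := eqVneq (enorm eta) 0.
  rewrite eb0 (enorm0_eq0 _ eb0) dotC dot0l.
  have := mulr_gt0 A0 (exprn_gt0 2 a0); nra.
have bgt0 : 0 < enorm eta by rewrite lt_def nb0.
have B0 : 0 < psi phi (enorm eta) by rewrite divr_gt0 ?phi0.
(* This is phi b <= (b / a) ^ c phi a combined with Bernoulli's inequality. *)
have hB : enorm eta * psi phi (enorm eta) <=
    (c * enorm eta + (1 - c) * enorm xi) * psi phi (enorm xi).
  rewrite /psi mulrC divfK ?gt_eqF//.
  apply: le_trans (phic _ _ bgt0 ba) _.
  have -> : (c * enorm eta + (1 - c) * enorm xi) * (phi (enorm xi) / enorm xi) =
      (c * (enorm eta / enorm xi) + (1 - c)) * phi (enorm xi).
    by field; rewrite gt_eqF.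
  by rewrite ler_wpM2r ?(ltW (phi0 _ a0))// powR_le_affine ?divr_gt0// c0.
move: (enorm xi) (enorm eta) (psi phi (enorm xi)) (psi phi (enorm eta))
  (dot xi eta) ba Dab b0 a0 A0 bgt0 B0 hB {na0 nb0} =>
  a b A B D ba Dab b0 a0 A0 bgt0 B0 hB.
have h1 : 0 <= (a * A - b * B - c * A * (a - b)) * (a - b).
  by apply: mulr_ge0; lra.
have h2 : 0 <= B * (a * b - D) by apply: mulr_ge0; lra.
have h3 : 0 <= (1 - c) * (A * (a * b - D)).
  by do 2?apply: mulr_ge0; lra.
have h4 : 0 <= c * (A * (a - b) ^+ 2).
  by apply: mulr_ge0 => //; apply: mulr_ge0; [lra|exact: sqr_ge0].
lra.
Qed.

Lemma field_of_coercive {R : realType} {d : nat}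
    (phi : R -> R) (c : R) (xi eta : 'rV[R]_d) :
  (forall s : R, 0 < s -> 0 < phi s) -> 0 <= c <= 1 -> power_growth c phi ->
  c / 2 * psi phi (Num.max (enorm xi) (enorm eta)) * enorm (xi - eta) ^+ 2 <=
  dot (field_of phi xi - field_of phi eta) (xi - eta).
Proof.
move=> phi0 c01 phic.
have [/ltW ab|ba] := ltP (enorm xi) (enorm eta); last first.
  exact: field_of_coercive_ordered.
rewrite enormB (le_trans (field_of_coercive_ordered _ _ _ _ phi0 c01 phic ab))//.
by rewrite le_eqVlt !(dotBl, dotBr); apply/orP; left; apply/eqP; ring.
Qed.

(** * Estimates for the primitive *)

Section Admissible.
Context {R : realType} {pm pp : R} {phi : R -> R}.
Context (adm : admissible pm pp phi).

Let phi_gt0 (s : R) : 0 < s -> 0 < phi s.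
Proof. by case: adm => _ _ _ + _; exact. Qed.

Lemma phi_power_growth (c : R) : c <= pm - 1 -> power_growth c phi.
Proof.
move=> cp; case: adm => _ dphi _ phi0 [_ H].
apply: log_derivative_power_growth => // s s0.
have /andP[h _] := H s s0; have := phi0 _ s0 => ps.
by rewrite -ler_pdivlMr// (le_trans cp).
Qed.

Let phi_cont (t : R) : {within `[0, t], continuous phi}%classic.
Proof.
case: adm => + _ _ _ _; apply: continuous_subspaceW => x /=.
by rewrite !in_itv/= andbT => /andP[].
Qed.

Lemma Phi0 : Phi phi 0 = 0.
Proof. by rewrite /Phi set_itv1 Rintegral_set1. Qed.

Let phi_integrable (t : R) :
  (@lebesgue_measure R).-integrable `[0, t]%classic (EFin \o phi).
Proof.
by apply: continuous_compact_integrable => //; exact: segment_compact.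
Qed.

Lemma Phi_continuous (t : R) : 0 <= t ->
  {within `[0, t], continuous (Phi phi)}%classic.
Proof. by move=> t0; exact: parameterized_integral_continuous. Qed.

Lemma Phi_derivative (t : R) : 0 < t ->
  derivable (Phi phi) t 1 /\ derive1 (Phi phi) t = phi t.
Proof.
move=> t0; apply: (@continuous_FTC1_closed _ phi 0 t (t + 1)) => //.
  by rewrite ltrDl.
apply/differentiable_continuous/derivable1_diffP.
by case: adm => _ + _ _ _; exact.
Qed.

Lemma Phi_gt0 (t : R) : 0 < t -> 0 < Phi phi t.
Proof.
move=> t0; rewrite -Phi0.
apply: (@gtr0_derive1_lt_cc _ (Phi phi) 0 t) => //.
- by move=> x; rewrite in_itv/= => /andP[/Phi_derivative[]].
- move=> x; rewrite in_itv/= => /andP[x0 _].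
  by rewrite (Phi_derivative _ x0).2 phi_gt0.
- exact/Phi_continuous/ltW.
- by rewrite in_itv/= lexx ltW.
- by rewrite in_itv/= lexx ltW.
Qed.

(** The function [s phi(s) - pm Phi(s)] vanishes at [0], is continuous up to [0],
    and has the nonnegative derivative [s phi'(s) - (pm - 1) phi(s)]. *)
Lemma pm_Phi_le (t : R) : 0 < t -> pm * Phi phi t <= t * phi t.
Proof.
move=> t0; rewrite -subr_ge0.
pose g (s : R) := s * phi s - pm * Phi phi s.
have g0 : g 0 = 0 by rewrite /g Phi0 mul0r mulr0 subr0.
rewrite -[leLHS]g0 -/(g t).
have dg (s : R) : 0 < s ->
    is_derive s 1 g ((s * derive1 phi s + phi s * 1) - pm * phi s).
  move=> s0.
  have fs : is_derive s 1 phi (derive1 phi s).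
    by rewrite derive1E; apply: DeriveDef => //; case: adm => _ + _ _ _; exact.
  have [dP eP] := Phi_derivative _ s0.
  have Fs : is_derive s 1 (Phi phi) (phi s).
    by apply: DeriveDef => //; rewrite -derive1E.
  exact: (is_deriveB (is_deriveM (is_derive_id s 1) fs) (is_deriveZ pm Fs)).
apply: (@ger0_derive1_le_cc _ g 0 t).
- by move=> x; rewrite in_itv/= => /andP[x0 _]; have := dg _ x0; case.
- move=> x; rewrite in_itv/= => /andP[x0 _].
  rewrite derive1E (@derive_val _ _ _ _ _ _ _ (dg _ x0)).
  case: adm => _ _ _ _ [_ /(_ _ x0)/andP[+ _]].
  rewrite ler_pdivlMr ?phi_gt0// => h; lra.
- have id_cont : {within `[0, t], continuous (@idfun R)}%classic.
    by apply: continuous_subspaceT => ?; exact: cvg_id.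
  have cst_cont : {within `[0, t], continuous (@cst R R pm)}%classic.
    by apply: continuous_subspaceT => ?; exact: cvg_cst.
  move=> x; apply: cvgB; apply: cvgM.
  + exact: id_cont.
  + exact: phi_cont.
  + exact: cst_cont.
  + exact/Phi_continuous/ltW.
- by rewrite in_itv/= lexx ltW.
- by rewrite in_itv/= lexx ltW.
- exact: ltW.
Qed.

(** In particular the infimum is positive, so that its inverse in the theorem is
    a genuine one. *)
Lemma le_lower_index : pm <= lower_index phi.
Proof.
apply: lb_le_inf; first by exists (1 * phi 1 / Phi phi 1); exists 1 => //=.
move=> _ [t /= t0 <-]; rewrite ler_pdivlMr ?Phi_gt0//.
exact: pm_Phi_le.
Qed.

Lemma Phi_power_growth : power_growth (lower_index phi) (Phi phi).
Proof.
apply: log_derivative_power_growth => s s0; have [dP dE] := Phi_derivative s s0.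
  exact: dP.
rewrite dE -ler_pdivlMr ?Phi_gt0//; apply: ge_inf; last by exists s.
exists pm => _ [t /= t0 <-]; rewrite ler_pdivlMr ?Phi_gt0//.
exact: pm_Phi_le.
Qed.

(** The threshold on [gamma] is exactly what makes
    [(h / s) ^ (lower_index * gamma)] at most [h / s] when [h <= s]. *)
Lemma Phi_ratio_powR (gamma h s : R) : (lower_index phi)^-1 <= gamma ->
  0 < h -> h <= s -> (Phi phi h / Phi phi s) `^ gamma <= h / s.
Proof.
move=> mg h0 hs; have s0 := lt_le_trans h0 hs.
have m0 : 0 < lower_index phi 
  by apply: lt_le_trans le_lower_index; case: adm => _ _ _ _ [pm1 _]; lra.
have g0 : 0 <= gamma by rewrite (le_trans _ mg)// invr_ge0 ltW.
have Ph := Phi_gt0 h h0; have Ps := Phi_gt0 s s0.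
have le1 : Phi phi h / Phi phi s <= (h / s) `^ lower_index phi.
  by rewrite ler_pdivrMr// Phi_power_growth.
apply: (@le_trans _ _ (((h / s) `^ lower_index phi) `^ gamma)).
  by rewrite ge0_ler_powR// nnegrE ?powR_ge0// divr_ge0 ?ltW.
rewrite -powRrM ge1r_powR//; first by rewrite divr_gt0//= ler_pdivrMr ?mul1r.
by rewrite mulrC -ler_pdivrMr// div1r.
Qed.

Lemma Phi_quotE (gamma h s : R) : 0 < h -> 0 < s -> 0 <= gamma ->
  Phi_quot phi gamma h s = Phi phi h * (Phi phi h / Phi phi s) `^ gamma.
Proof.
move=> h0 s0 g0; have Ph := Phi_gt0 h h0; have Ps := Phi_gt0 s s0.
rewrite /Phi_quot powRD; last by rewrite (gt_eqF Ph) implybT.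
rewrite (powRr1 (ltW Ph)) powRM ?invr_ge0 ?(ltW Ph) ?(ltW Ps)//.
by rewrite -[in RHS](powR_inv1 (ltW Ps)) powRAC powR_inv1 ?powR_ge0// mulrA.
Qed.

End Admissible.

(** * The monotonicity inequalities *)

Theorem lemma11 (R : realType) :
  exists kappa : R, 0 < kappa < 1 /\
  forall (d : nat) (pm pp : R) (phi : R -> R), admissible pm pp phi ->
    (forall gamma : R, (lower_index phi)^-1 <= gamma ->
      forall xi eta : 'rV[R]_d,
        Num.min (pm - 1) 1 * pm *
          Num.min
            (Phi_quot phi gamma ((Num.sqrt 3)^-1 * enorm (xi - eta))
               (enorm xi + enorm eta))
            (Phi_quot phi gamma (Num.sqrt kappa * enorm (xi - eta))
               (enorm xi + enorm eta) / 4)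
        <= dot (field_of phi xi - field_of phi eta) (xi - eta)) /\
    (2 <= pm ->
      forall xi eta : 'rV[R]_d,
        Num.min (Phi phi (enorm (xi - eta)))
          (pm / 4 * Phi phi (Num.sqrt kappa * enorm (xi - eta)))
        <= dot (field_of phi xi - field_of phi eta) (xi - eta)).
Proof.
exists 4^-1; split; first by apply/andP; split; lra.
move=> d pm pp phi adm.
have -> : Num.sqrt (4^-1 : R) = 2^-1.
  have -> : (4^-1 : R) = 2^-1 ^+ 2 by field.
  by rewrite sqrtr_sqr ger0_norm ?invr_ge0.
have phi_gt0 : forall s : R, 0 < s -> 0 < phi s by case: adm.
have pm_gt1 : 0 < pm - 1 by case: adm => _ _ _ _ [].
have hc : 0 <= Num.min (pm - 1) 1 <= 1.
  by rewrite ge_min lexx orbT andbT le_min ler01 andbT ltW.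
have phi_growth : power_growth (Num.min (pm - 1) 1) phi.
  by apply: (phi_power_growth adm); rewrite ge_min lexx.
have coer (xi eta : 'rV[R]_d) :=
  field_of_coercive phi _ xi eta phi_gt0 hc phi_growth.
have half_le_max (xi eta : 'rV[R]_d) :
    2^-1 * enorm (xi - eta) <= Num.max (enorm xi) (enorm eta).
  have := enormB_le xi eta; rewrite le_max.
  by case: (lerP (enorm xi) (enorm eta)) => ab sum; apply/orP; [right|left]; lra.
split=> [gamma mg xi eta|pm2 xi eta].
- apply: (le_trans _ (coer xi eta)).
  set c := Num.min (pm - 1) 1 in hc phi_growth *.
  have /andP[c0 c1] := hc.
  have cpm : 0 <= c * pm by apply: mulr_ge0; lra.
  set r := enorm (xi - eta); set h := 2^-1 * r.
  set a := Num.max _ _; set s := enorm xi + enorm eta.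
  apply: (@le_trans _ _ (c * pm * (Phi_quot phi gamma h s / 4))).
    by rewrite ler_wpM2l// ge_min lexx orbT.
  have ha : h <= a := half_le_max xi eta.
  have as_ : a <= s.
    by rewrite /a /s ge_max lerDl lerDr !enorm_ge0.
  have m0 : 0 < lower_index phi.
    by apply: lt_le_trans (le_lower_index adm); lra.
  have g0 : 0 < gamma by rewrite (lt_le_trans _ mg)// invr_gt0.
  have r0 : 0 <= r := enorm_ge0 _.
  (* At r = 0 the quotient vanishes as Phi 0 = 0, even when xi = eta = 0. *)
  have [er|nr] := eqVneq r 0.
    rewrite /h er mulr0 /Phi_quot Phi0 powR0; last by rewrite gt_eqF; lra.
    lra.
  have h0 : 0 < h by rewrite mulr_gt0 ?invr_gt0// lt_def nr.
  have a0 := lt_le_trans h0 ha; have s0 := lt_le_trans a0 as_.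
  rewrite (Phi_quotE adm _ _ _ h0 s0 (ltW g0)).
  have e1 := Phi_ratio_powR adm _ _ _ mg h0 (le_trans ha as_).
  have phi_ha : phi h <= phi a.
    apply: le_trans (phi_growth _ _ h0 ha) _.
    rewrite ler_piMl ?(ltW (phi_gt0 _ a0))// -[leRHS](powRr0 (h / a)).
    by rewrite ger_powR// divr_gt0//= ler_pdivrMr ?mul1r.
  have pmPhi : pm * Phi phi h <= h * phi a.
    by rewrite (le_trans (pm_Phi_le adm _ h0))// ler_pM2l.
  have ratio := Phi_ratio_powR adm _ _ _ mg h0 (le_trans ha as_).
  have hsa : h / s <= h / a by rewrite ler_pM2l// lef_pV2.
  have key : pm * Phi phi h * (Phi phi h / Phi phi s) `^ gamma <=
      h * phi a * (h / a).
    apply: ler_pM => //; rewrite ?powR_ge0//; last exact: le_trans ratio hsa.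
    by rewrite mulr_ge0 ?(ltW (Phi_gt0 adm _ h0))//; lra.
  have -> : r = 2 * h by rewrite /h; field.
  have -> : c / 2 * psi phi a * (2 * h) ^+ 2 = 2 * (c * (h * phi a * (h / a))).
    by rewrite /psi; field; rewrite gt_eqF.
  have := ler_wpM2l c0 key.
  have : 0 <= c * (h * phi a * (h / a)).
    by rewrite !mulr_ge0 ?invr_ge0 ?(ltW (phi_gt0 _ a0)) ?(ltW h0) ?(ltW a0).
  lra.
- apply: (le_trans _ (coer xi eta)).
  rewrite ge_min; apply/orP; right.
  have c1 : Num.min (pm - 1) 1 = 1 by apply/min_idPr; lra.
  rewrite c1 in phi_growth *.
  set r := enorm (xi - eta); set h := 2^-1 * r; set a := Num.max _ _.
  have ha : h <= a := half_le_max xi eta.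
  have r0 : 0 <= r := enorm_ge0 _.
  have [er|nr] := eqVneq r 0.
    by rewrite /h er mulr0 (Phi0 (phi := phi)) expr0n !mulr0.
  have h0 : 0 < h by rewrite mulr_gt0 ?invr_gt0// lt_def nr.
  have a0 := lt_le_trans h0 ha.
  have phi_ha : phi h <= h / a * phi a.
    by have := phi_growth _ _ h0 ha; rewrite powRr1 ?divr_ge0 ?(ltW h0) ?(ltW a0).
  have key : pm * Phi phi h <= h * (h / a * phi a).
    by rewrite (le_trans (pm_Phi_le adm _ h0))// ler_pM2l.
  have -> : r = 2 * h by rewrite /h; field.
  have -> : 1 / 2 * psi phi a * (2 * h) ^+ 2 = 2 * (h * (h / a * phi a)).
    by rewrite /psi; field; rewrite gt_eqF.
  have : 0 <= h * (h / a * phi a).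
    by rewrite !mulr_ge0 ?invr_ge0 ?(ltW (phi_gt0 _ a0)) ?(ltW h0) ?(ltW a0).
  lra.
Qed.
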